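(* Let $\lambda\in\mathbb{R}$, let $Y$ be a random variable whose moment generating function exists in a neighborhood of the origin, and let $x\in[0,1]$. For all integers $n\ge k\ge 0$, \[ B_{k,n}^{Y}(x|\lambda)=(x)_{k,\lambda}\sum_{m=k}^{n}\sum_{j=0}^{m-k}\binom{n}{m}\beta_{n-m,\lambda}^{(k,Y)}(kx)\binom{k+j}{j}\binom{1-x-kx}{j}\,j!\,{m \brace k+j}_{Y,\lambda}. \]
   Context: For $\lambda\in\mathbb{R}$, $(x)_{0,\lambda}=1$, $(x)_{n,\lambda}=x(x-\lambda)\cdots(x-(n-1)\lambda)$ for $n\ge1$, and $e_\lambda^x(t)=\sum_{n\ge0}(x)_{n,\lambda}\frac{t^n}{n!}$. For the random variable $Y$, $E[e_\lambda^Y(t)]$ denotes the power series $\sum_{n\ge0}E[(Y)_{n,\lambda}]\frac{t^n}{n!}$ (constant term $1$); for real $a$, $(E[e_\lambda^Y(t)])^a=\sum_{j\ge0}\binom{a}{j}(E[e_\lambda^Y(t)]-1)^j$. The probabilistic degenerate Stirling numbers of the second kind: $\frac{1}{k!}(E[e_\lambda^Y(t)]-1)^k=\sum_{n\ge k}{n\brace k}_{Y,\lambda}\frac{t^n}{n!}$. The probabilistic degenerate Bernoulli polynomials of order $r$: $\Big(\frac{t}{E[e_\lambda^Y(t)]-1}\Big)^r(E[e_\lambda^Y(t)])^x=\sum_{n\ge0}\beta_{n,\lambda}^{(r,Y)}(x)\frac{t^n}{n!}$. The probabilistic degenerate Bernstein polynomials: $\frac{1}{k!}(x)_{k,\lambda}t^k(E[e_\lambda^Y(t)])^{1-x}=\sum_{n\ge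 k}B_{k,n}^{Y}(x|\lambda)\frac{t^n}{n!}$.
   Formalization: For k ≥ 1 the formal statement assumes E[Y] ≠ 0, since otherwise (t/(E[e_λ^Y(t)]−1))^k is not a power series and the order-k Bernoulli polynomials on the right-hand side are undefined. *)

(* Defs.v *)
From HB Require Import structures.
From mathcomp Require Import all_boot all_order all_algebra.
From mathcomp Require Import zify.
From mathcomp Require Import all_classical all_reals all_analysis.

Set Implicit Arguments.
Unset Strict Implicit.
Unset Printing Implicit Defensive.

Import Order.TTheory GRing.Theory Num.Theory.
Import numFieldNormedType.Exports.

Local Open Scope ring_scope.

(* Formal power series; [f n] is the coefficient of t ^ n. A record rather than
   an alias of [nat -> R], so that [*] and [^+] are never taken pointwise. *)
Record fps (R : Type) := Fps { fps_coef : nat -> R }.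
Coercion fps_coef : fps >-> Funclass.

Lemma fpsP (R : Type) (f g : fps R) : f =1 g -> f = g.
Proof. by case: f g => [f] [g] /= /funext ->. Qed.

Section FpsRing.
Variable R : fieldType.
Implicit Types f g h : fps R.

HB.instance Definition _ := gen_eqMixin (fps R).
HB.instance Definition _ := gen_choiceMixin (fps R).

Definition fps_zero : fps R := Fps (fun=> 0).
Definition fps_opp f : fps R := Fps (fun n => - f n).
Definition fps_add f g : fps R := Fps (fun n => f n + g n).

Fact fps_addA : associative fps_add.
Proof. by move=> f g h; apply: fpsP => n; exact: addrA. Qed.

Fact fps_addC : commutative fps_add.
Proof. by move=> f g; apply: fpsP => n; exact: addrC. Qed.

Fact fps_add0 : left_id fps_zero fps_add.
Proof. by move=> f; apply: fpsP => n; exact: add0r. Qed.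

Fact fps_addN : left_inverse fps_zero fps_opp fps_add.
Proof. by move=> f; apply: fpsP => n; exact: addNr. Qed.

HB.instance Definition _ := GRing.isZmodule.Build (fps R)
  fps_addA fps_addC fps_add0 fps_addN.

Definition fps_one : fps R := Fps (fun n => (n == 0%N)%:R).
Definition fps_mul f g : fps R := Fps (fun n => \sum_(i < n.+1) f i * g (n - i)%N).

Definition fps_trunc N f : {poly R} := \poly_(i < N.+1) f i.

Fact coef_fps_trunc N f n : (n <= N)%N -> (fps_trunc N f)`_n = f n.
Proof. by move=> nN; rewrite coef_poly ltnS nN. Qed.

Fact fps_mul_trunc N f g n : (n <= N)%N ->
  fps_mul f g n = (fps_trunc N f * fps_trunc N g)`_n.
Proof.
move=> nN; rewrite coefM; apply: eq_bigr => i _.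
by rewrite !coef_fps_trunc // (leq_trans _ nN) ?leq_subr // -ltnS.
Qed.

Fact fps_mulA : associative fps_mul.
Proof.
move=> f g h; apply: fpsP => n; rewrite !(@fps_mul_trunc n) //.
transitivity ((fps_trunc n f * (fps_trunc n g * fps_trunc n h))`_n).
  rewrite !coefM; apply: eq_bigr => i _; congr (_ * _).
  by rewrite coef_fps_trunc ?leq_subr // (@fps_mul_trunc n) ?leq_subr.
rewrite mulrA !coefM; apply: eq_bigr => i _; congr (_ * _).
by rewrite coef_fps_trunc ?(@fps_mul_trunc n) // -ltnS.
Qed.

Fact fps_mulC : commutative fps_mul.
Proof. by move=> f g; apply: fpsP => n; rewrite !(@fps_mul_trunc n) // mulrC. Qed.

Fact fps_mul1 : left_id fps_one fps_mul.
Proof.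
move=> f; apply: fpsP => n /=; rewrite big_ord_recl /= mul1r subn0.
by rewrite big1 ?addr0 // => i _; rewrite mul0r.
Qed.

Fact fps_mulDl : left_distributive fps_mul +%R.
Proof.
move=> f g h; apply: fpsP => n /=; rewrite -big_split /=.
by apply: eq_bigr => i _; rewrite mulrDl.
Qed.

Fact fps_one_neq0 : fps_one != 0.
Proof.
by apply/eqP => /(congr1 (fun f => fps_coef f 0%N)) /= /eqP; rewrite oner_eq0.
Qed.

HB.instance Definition _ := GRing.Zmodule_isComNzRing.Build (fps R)
  fps_mulA fps_mulC fps_mul1 fps_mulDl fps_one_neq0.

Lemma fps_coef0 n : (0 : fps R) n = 0. Proof. by []. Qed.
Lemma fps_coef1 n : (1 : fps R) n = (n == 0%N)%:R. Proof. by []. Qed.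
Lemma fps_coefN f n : (- f) n = - f n. Proof. by []. Qed.
Lemma fps_coefD f g n : (f + g) n = f n + g n. Proof. by []. Qed.
Lemma fps_coefB f g n : (f - g) n = f n - g n. Proof. by []. Qed.
Lemma fps_coefM f g n : (f * g) n = \sum_(i < n.+1) f i * g (n - i)%N.
Proof. by []. Qed.

Lemma fps_coef_sum (I : Type) (r : seq I) (P : pred I) (F : I -> fps R) n :
  (\sum_(i <- r | P i) F i) n = \sum_(i <- r | P i) F i n.
Proof. by elim/big_rec2: _ => // i x y _ <-. Qed.

Lemma fps_coefX_lt f j n : f 0%N = 0 -> (n < j)%N -> (f ^+ j) n = 0.
Proof.
move=> f0; elim: j n => // j IH n ltnj; rewrite exprS fps_coefM.
rewrite big1 // => -[[|i] /= lti] _; first by rewrite f0 mul0r.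
rewrite IH ?mulr0 //; lia.
Qed.

Definition fpsC (c : R) : fps R := Fps (fun n => c *+ (n == 0%N)).
Definition fpsX : fps R := Fps (fun n => (n == 1%N)%:R).

Lemma fps_coefCM c f n : (fpsC c * f) n = c * f n.
Proof.
rewrite fps_coefM big_ord_recl /= subn0 big1 ?addr0 // => i _.
by rewrite /= mulr0n mul0r.
Qed.

Lemma fps_coefXM f n : (fpsX * f) n = if n is m.+1 then f m else 0.
Proof.
rewrite fps_coefM big_ord_recl /= mul0r add0r; case: n => [|n].
  by rewrite big_ord0.
rewrite big_ord_recl /= mul1r subSS subn0 big1 ?addr0 // => i _.
by rewrite /= mul0r.
Qed.

(* The series \sum_(j >= 0) a j * g ^ j, for g with zero constant term: then
   g ^ j has no term of degree < j, so that only j <= n contributes to the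
   coefficient of t ^ n. *)
Definition fps_subst (a : nat -> R) g : fps R :=
  Fps (fun n => \sum_(j < n.+1) a j * (g ^+ j) n).

Lemma fps_substE a g N n : g 0%N = 0 -> (n <= N)%N ->
  fps_subst a g n = (\sum_(j < N.+1) fpsC (a j) * g ^+ j) n.
Proof.
move=> g0 nN; rewrite fps_coef_sum [LHS]/=.
rewrite (big_ord_widen N.+1 (fun j => a j * (g ^+ j) n)) // big_mkcond.
apply: eq_bigr => j _; rewrite fps_coefCM; case: ltnP => // ltnj.
by rewrite fps_coefX_lt ?mulr0.
Qed.

(* 1 / f = (f 0)^-1 * \sum_(j >= 0) (1 - f / f 0) ^ j *)
Definition fps_inv f : fps R :=
  if f 0%N == 0 then f
  else fpsC (f 0%N)^-1 * fps_subst (fun=> 1) (1 - fpsC (f 0%N)^-1 * f).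

Definition fps_unit : {pred fps R} := [pred f : fps R | f 0%N != 0].

Fact fps_mulVf : {in fps_unit, left_inverse (1 : fps R) fps_inv *%R}.
Proof.
move=> f; rewrite inE => f0; rewrite /fps_inv (negPf f0).
set g := 1 - _; rewrite -mulrA mulrCA.
have -> : fpsC (f 0%N)^-1 * f = 1 - g by rewrite opprB addrCA subrr addr0.
have g0 : g 0%N = 0 by rewrite fps_coefB fps_coefCM mulVf // subrr.
apply: fpsP => n.
transitivity (((\sum_(j < n.+1) g ^+ j) * (1 - g)) n).
  rewrite !fps_coefM; apply: eq_bigr => i _; congr (_ * _).
  rewrite (fps_substE _ g0 (_ : i <= n)%N) -1?ltnS // !fps_coef_sum.
  by apply: eq_bigr => j _; rewrite fps_coefCM mul1r.
rewrite mulrC -opprB mulNr -subrX1 opprB fps_coefB fps_coefX_lt //.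
by rewrite subr0.
Qed.

Fact fps_unitPl f g : g * f = 1 -> fps_unit f.
Proof.
move=> /(congr1 (fun h => fps_coef h 0%N)); rewrite fps_coefM big_ord1 /= => gf.
by apply/eqP => f0; move/eqP: gf; rewrite f0 mulr0 eq_sym oner_eq0.
Qed.

Fact fps_inv_out : {in [predC fps_unit], fps_inv =1 id}.
Proof. by move=> f; rewrite !inE negbK /fps_inv => ->. Qed.

HB.instance Definition _ := GRing.ComNzRing_hasMulInverse.Build (fps R)
  fps_mulVf fps_unitPl fps_inv_out.

(* The power series t / f for f = c1 t + c2 t ^ 2 + ... with c1 != 0, as the
   inverse of f / t = c1 + c2 t + ... . *)
Definition fps_Xdiv f : fps R := (Fps (fun n => f n.+1))^-1.

Lemma fps_XdivK f : f 0%N = 0 -> f 1%N != 0 -> fps_Xdiv f * f = fpsX.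
Proof.
move=> f0 f1; rewrite /fps_Xdiv; set h := Fps _.
have -> : f = fpsX * h by apply: fpsP => -[|n]; rewrite fps_coefXM.
by rewrite mulrCA mulVr ?mulr1.
Qed.

(* Coefficient of t ^ n / n! *)
Definition egf_coef f n : R := n`!%:R * f n.

Definition gbinom (a : R) (j : nat) : R :=
  (\prod_(i < j) (a - i%:R)) / j`!%:R.

(* f ^ a = \sum_(j >= 0) binom(a, j) (f - 1) ^ j, for f with constant term 1 *)
Definition fps_rpow f (a : R) : fps R := fps_subst (gbinom a) (f - 1).

Definition dfall (lambda x : R) (n : nat) : R :=
  \prod_(i < n) (x - i%:R * lambda).

End FpsRing.

Section ProbabilisticDegenerate.
Context d (T : measurableType d) (R : realType) (P : probability T R).
Variables (lambda : R) (Y : {RV P >-> R}).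

(* E[e_lambda^Y(t)] *)
Definition Edegexp : fps R :=
  Fps (fun n => fine 'E_P[fun w => dfall lambda (Y w) n] / n`!%:R).

Lemma Edegexp0 : Edegexp 0%N = 1.
Proof.
rewrite /= fact0 divr1 (_ : (fun w => _) = cst 1) ?expectation_cst //.
by apply/funext => w; rewrite /dfall big_ord0.
Qed.

Lemma Edegexp1 : Edegexp 1%N = fine 'E_P[Y].
Proof.
rewrite /= divr1; congr (fine 'E_P[_]).
by apply/funext => w; rewrite /dfall big_ord1 mul0r subr0.
Qed.

Definition pdStirling2 (n k : nat) : R :=
  egf_coef (fpsC (k`!%:R)^-1 * (Edegexp - 1) ^+ k) n.

(* Meaningful for r = 0 or 'E_P[Y] != 0: otherwise t / (E[e_lambda^Y(t)] - 1)
   is not a power series. *)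
Definition pdBernoulli (r n : nat) (x : R) : R :=
  egf_coef (fps_Xdiv (Edegexp - 1) ^+ r * fps_rpow Edegexp x) n.

Definition pdBernstein (k n : nat) (x : R) : R :=
  egf_coef (fpsC ((k`!%:R)^-1 * dfall lambda x k) * fpsX R ^+ k
            * fps_rpow Edegexp (1 - x)) n.

End ProbabilisticDegenerate.

(* Main.v *)
(** Write E for E[e_lambda^Y(t)] and F = E - 1.  Since F has no constant term and
    its linear coefficient E[Y] is nonzero, t^k = (t / F)^k F^k.  Splitting
    E^(1-x) = E^(kx) E^a with a = 1 - x - kx, the generating function of the
    Bernstein polynomials is (x)_{k,lambda} times the product of
    (t / F)^k E^(kx), which generates the Bernoulli polynomials of order k, and
    F^k E^a / k! = \sum_j binom(a, j) binom(k + j, j) j! F^(k+j) / (k+j)!,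
    which generates the Stirling numbers. *)

Require Import Defs.
From HB Require Import structures.
From mathcomp Require Import all_boot all_order all_algebra ring lra zify.
From mathcomp Require Import all_classical all_reals all_analysis.
From mathcomp Require Import measurable_realfun.

Import Order.TTheory GRing.Theory Num.Theory.
Import numFieldNormedType.Exports.

Local Open Scope classical_set_scope.
Local Open Scope ring_scope.

Lemma sum_nat_truncr (V : nmodType) (F : nat -> V) m n :
  (m <= n)%N -> (forall i, (m <= i)%N -> F i = 0) ->
  \sum_(0 <= i < n) F i = \sum_(0 <= i < m) F i.
Proof.
move=> mn F0; rewrite (big_cat_nat (n := m)) //= [X in _ + X]big_nat_cond.
by rewrite [X in _ + X]big1 ?addr0 // => i /andP[/andP[mi _] _]; exact: F0.
Qed.

Lemma sum_nat_truncl (V : nmodType) (F : nat -> V) m n :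
  (m <= n)%N -> (forall i, (i < m)%N -> F i = 0) ->
  \sum_(0 <= i < n) F i = \sum_(m <= i < n) F i.
Proof.
move=> mn F0; rewrite (big_cat_nat (n := m)) //= big_nat_cond.
by rewrite big1 ?add0r // => i /andP[/andP[_ im] _]; exact: F0.
Qed.

(** The coefficient of t ^ n sees only the powers g ^ j with j <= n, so h distributes over a finite
    sum and no convergence argument is needed. *)
Lemma fps_coefM_subst (R : fieldType) (a : nat -> R) (g h : fps R) n :
  g 0%N = 0 ->
  (h * fps_subst a g) n = \sum_(j < n.+1) a j * (h * g ^+ j) n.
Proof.
move=> g0.
transitivity ((h * \sum_(j < n.+1) fpsC (a j) * g ^+ j) n).
  rewrite !fps_coefM; apply: eq_bigr => i _.
  by rewrite (fps_substE _ g0 (leq_subr i n)).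
rewrite mulr_sumr fps_coef_sum; apply: eq_bigr => j _.
by rewrite mulrCA fps_coefCM.
Qed.

(** Cauchy product: the terms a i * b j * g ^ (i + j) are regrouped by s = i + j. *)
Lemma fps_substM (R : fieldType) (a b : nat -> R) (g : fps R) :
  g 0%N = 0 ->
  fps_subst a g * fps_subst b g =
  fps_subst (fun n => \sum_(i < n.+1) a i * b (n - i)%N) g.
Proof.
move=> g0; apply: fpsP => n.
rewrite mulrC fps_coefM_subst // [RHS]/=.
under [LHS]eq_bigr => i _.
  rewrite [fps_subst b g * _]mulrC fps_coefM_subst // mulr_sumr.
  rewrite -(big_mkord xpredT (fun j => a i * (b j * (g ^+ i * g ^+ j) n))).
  (* For i + j > n the power g ^ (i + j) has no coefficient of degree n, so the square of indices
     shrinks to the triangle i + j <= n. *)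
  rewrite (sum_nat_truncr _ _ _ _ (leq_subr i n.+1)); last first.
    move=> j ij; rewrite -exprD fps_coefX_lt ?mulr0 //; lia.
over.
under [RHS]eq_bigr => s _.
  rewrite mulr_suml.
  rewrite (big_ord_widen n.+1 (fun i => a i * b (s - i)%N * (g ^+ s) n)) //.
over.
(* For fixed i, the index s runs from i to n; shifting it by i gives back j. *)
rewrite [RHS](exchange_big_dep xpredT) //; apply: eq_bigr => i _.
rewrite -(big_mkord (fun s => i < s.+1)%N
  (fun s => a i * b (s - i)%N * (g ^+ s) n)).
rewrite [RHS]big_mkcond [RHS](sum_nat_truncl _ _ _ _ (ltnW (ltn_ord i))); last first.
  by move=> s si; case: ifP => //; lia.
rewrite -[X in _ = \sum_(X <= _ < _) _]add0n big_addn; apply: eq_bigr => s _.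
by rewrite addnK -exprD addnC mulrA ltnS leq_addl.
Qed.

Lemma gbinomS (R : numFieldType) (a : R) n :
  n.+1%:R * gbinom a n.+1 = (a - n%:R) * gbinom a n.
Proof.
rewrite /gbinom big_ord_recr /= factS natrM invfM.
have : n.+1%:R != 0 :> R by rewrite pnatr_eq0.
have : n`!%:R != 0 :> R by rewrite pnatr_eq0 -lt0n fact_gt0.
by move: (n.+1%:R) (n`!%:R) => u v u0 v0; field; rewrite u0 v0.
Qed.

(* Both sides satisfy (n + 1) S (n + 1) = (a + b - n) S n. *)
Lemma gbinomD (R : numFieldType) (a b : R) n :
  \sum_(i < n.+1) gbinom a i * gbinom b (n - i)%N = gbinom (a + b) n.
Proof.
elim: n => [|n IH].
  by rewrite big_ord1 /gbinom !big_ord0 fact0 invr1 !mulr1.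
have n0 : n.+1%:R != 0 :> R by rewrite pnatr_eq0.
apply: (mulfI n0); rewrite gbinomS -IH.
(* Splitting n + 1 = i + (n + 1 - i) gives each binomial the factor that [gbinomS] requires. *)
transitivity
  (\sum_(i < n.+2) i%:R * gbinom a i * gbinom b (n.+1 - i)%N
   + \sum_(i < n.+2) gbinom a i * ((n.+1 - i)%:R * gbinom b (n.+1 - i)%N)).
  rewrite -big_split mulr_sumr; apply: eq_bigr => i _ /=.
  rewrite natrB -1?ltnS //; ring.
(* The first sum loses its term i = 0 and the second its term i = n + 1. After reindexing, the
   factors add up to (a - i) + (b - (n - i)) = a + b - n. *)
rewrite big_ord_recl !mul0r add0r [X in _ + X]big_ord_recr /=.
rewrite subnn mul0r mulr0 addr0 -big_split mulr_sumr; apply: eq_bigr => i _ /=.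
have /ltnSE le_in := ltn_ord i.
rewrite /bump /= add1n subSS gbinomS subSn // gbinomS natrB //; ring.
Qed.

(** By the Cauchy product [fps_substM], the exponent law reduces to the Vandermonde identity
    [gbinomD]. *)
Lemma fps_rpowD (R : numFieldType) (f : fps R) (a b : R) :
  f 0%N = 1 -> fps_rpow f (a + b) = fps_rpow f a * fps_rpow f b.
Proof.
move=> f0; rewrite /fps_rpow fps_substM ?fps_coefB ?f0 ?subrr //.
by congr (fps_subst _ _); apply/funext => n; rewrite gbinomD.
Qed.

Lemma egf_coefM (R : numFieldType) (f g : fps R) n :
  egf_coef (f * g) n =
  \sum_(0 <= m < n.+1) 'C(n, m)%:R * egf_coef f (n - m) * egf_coef g m.
Proof.
rewrite /egf_coef mulrC [f * g]mulrC fps_coefM mulr_suml big_mkord.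
apply: eq_bigr => m _; have le_mn : (m <= n)%N by rewrite -ltnS.
rewrite -(bin_fact le_mn) !natrM; ring.
Qed.

(* |Y| <= (exp (tY) + exp (- tY)) / t for a small t > 0.  Finiteness of E[Y]
   matters because [fine] sends an infinite expectation to 0. *)
Lemma mgf_integrable (d : measure_display) (T : measurableType d) (R : realType)
    (P : probability T R) (Y : {RV P >-> R}) :
  (\forall t \near (0 : R), ('M_P Y t < +oo)%E) ->
  P.-integrable setT (EFin \o Y).
Proof.
move=> /nbhs_ballP[e /= e0 mgfY].
pose t := e / 2; have t0 : 0 < t by rewrite divr_gt0.
have int_exp s : `|s| < e ->
    P.-integrable setT (EFin \o (fun w => expR (Y w * s))).
  move=> se; have mf : measurable_fun setT (fun w => expR (Y w * s)).
    apply: measurableT_comp => //; exact: measurableT_comp (mulrr_measurable s) _.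
  apply/integrableP; split; first exact/measurable_EFinP.
  have : ('M_P Y s < +oo)%E by apply: mgfY; rewrite /ball /= sub0r normrN.
  rewrite /mmt_gen_fun unlock; congr (_ < _)%E; apply: eq_integral => w _ /=.
  by rewrite ger0_norm ?expR_ge0.
have te : `|t| < e by rewrite gtr0_norm // /t; lra.
have Nte : `|- t| < e by rewrite normrN.
have := integrableZl measurableT t^-1
  (integrableD measurableT (int_exp _ te) (int_exp _ Nte)).
apply: le_integrable => //; first exact/measurable_EFinP.
move=> w _ /=; rewrite lee_fin ler_normr.
rewrite mulrC ler_pdivlMr //; apply/orP; left.
(* From 1 + u <= exp u at u = tY and u = - tY, the exponential whose exponent is t|Y| bounds t|Y|,
   and the other one is nonnegative. *)
have := expR_ge0 (Y w * t); have := expR_ge0 (Y w * - t).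
have := expR_ge1Dx (Y w * t); have := expR_ge1Dx (Y w * - t).
by have [Y0|Y0] := ger0P (Y w); rewrite ?mulrN ?mulNr; lra.
Qed.

Theorem theorem2p6 (d : measure_display) (T : measurableType d) (R : realType)
    (P : probability T R) (lambda : R) (Y : {RV P >-> R})
    (mgfY : \forall t \near (0 : R), ('M_P Y t < +oo)%E)
    (x : R) (x01 : 0 <= x <= 1) (n k : nat) (kn : (k <= n)%N)
    (EY : (0 < k)%N -> 'E_P[Y]%E != 0%E) :
  pdBernstein lambda Y k n x =
  dfall lambda x k *
  \sum_(k <= m < n.+1) \sum_(0 <= j < (m - k).+1)
    'C(n, m)%:R * pdBernoulli lambda Y k (n - m) (k%:R * x)
    * 'C(k + j, j)%:R * gbinom (1 - x - k%:R * x) j * j`!%:R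
    * pdStirling2 lambda Y m (k + j).
Proof.
set F := Edegexp lambda Y - 1.
have E0 := Edegexp0 lambda Y.
have F0 : F 0%N = 0 by rewrite fps_coefB E0 subrr.
have XkE : fpsX R ^+ k = fps_Xdiv F ^+ k * F ^+ k.
  (* The case k = 0 is separate because [EY] gives E[Y] != 0 only for positive k. *)
  case: k EY {kn} => [|k] EY; first by rewrite !expr0 mulr1.
  rewrite -exprMn fps_XdivK // fps_coefB fps_coef1 subr0 Edegexp1.
  (* Once E[Y] is known to be finite, [fine] keeps it nonzero. *)
  rewrite fine_eq0 ?EY // unlock.
  exact/(integrable_fin_num measurableT)/mgf_integrable.
set a := 1 - x - k%:R * x.
have -> : pdBernstein lambda Y k n x = dfall lambda x k *
    egf_coef (fps_Xdiv F ^+ k * fps_rpow (Edegexp lambda Y) (k%:R * x)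
              * (fpsC (k`!%:R)^-1 * F ^+ k * fps_rpow (Edegexp lambda Y) a)) n.
  rewrite /pdBernstein (_ : 1 - x = k%:R * x + a); last by rewrite /a; ring.
  rewrite fps_rpowD // XkE /egf_coef [RHS]mulrCA; congr (_ * _).
  rewrite -fps_coefCM; congr (fps_coef _ n).
  have -> : fpsC (k`!%:R^-1 * dfall lambda x k) =
            fpsC (dfall lambda x k) * fpsC (k`!%:R^-1).
    by apply: fpsP => i; rewrite fps_coefCM /= mulrnAr mulrC.
  ring.
(* The second factor is a multiple of F ^ k, so its coefficients of degree m < k vanish and the
   convolution starts at m = k. *)
congr (_ * _); rewrite egf_coefM (sum_nat_truncl _ _ _ _ (leqW kn)) => [|m mk]; last first.
  rewrite [egf_coef (_ * _ * fps_rpow _ _) _]/egf_coef fps_coefM_subst //.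
  rewrite big1 ?mulr0 //.
  move=> j _; rewrite -mulrA -exprD fps_coefCM fps_coefX_lt ?mulr0 //; lia.
apply: eq_big_nat => m /andP[km _].
transitivity ('C(n, m)%:R * pdBernoulli lambda Y k (n - m) (k%:R * x) *
  \sum_(0 <= j < (m - k).+1) 'C(k + j, j)%:R * gbinom a j * j`!%:R
    * pdStirling2 lambda Y m (k + j)); last first.
  by rewrite mulr_sumr; apply: eq_bigr => j _; rewrite !mulrA.
congr (_ * _); rewrite /egf_coef fps_coefM_subst // mulr_sumr.
rewrite -(big_mkord xpredT (fun j => m`!%:R *
  (gbinom a j * (fpsC k`!%:R^-1 * F ^+ k * F ^+ j) m))).
(* F ^ (k + j) has no term of degree m once j > m - k. *)
rewrite (@sum_nat_truncr _ _ (m - k).+1) ?ltnS ?leq_subr //; last first.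
  move=> j mj.
  rewrite -mulrA -exprD fps_coefCM fps_coefX_lt ?mulr0 //; lia.
apply: eq_bigr => j _.
rewrite -mulrA -exprD /pdStirling2 /egf_coef !fps_coefCM.
(* The identity binom(k + j, j) j! k! = (k + j)! turns the factor 1 / k! into the 1 / (k + j)! of
   the Stirling numbers. *)
have /(congr1 (fun i => i%:R : R)) := bin_fact (leq_addl k j).
rewrite addnK !natrM => <-.
have k0 : k`!%:R != 0 :> R by rewrite pnatr_eq0 -lt0n fact_gt0.
have j0 : j`!%:R != 0 :> R by rewrite pnatr_eq0 -lt0n fact_gt0.
have c0 : 'C(k + j, j)%:R != 0 :> R by rewrite pnatr_eq0 -lt0n bin_gt0 leq_addl.
by field; rewrite k0 j0 c0.
Qed.
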